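(* There is an absolute constant $c>0$ such that the following holds. Let $\epsilon>0$, $\delta\in(0,1)$, assume $C_2<\infty$, $\epsilon_{\mathcal G,\mathcal V,\mathcal P}=\epsilon_{\mathcal V,\mathcal P}=0$, and $0<\lambda\le\frac{(1-\gamma)\epsilon}{2\ln|\mathcal A|}$. If $$n\ge c\,\frac{C_2\,V_{\lambda,\max}^2\ln\frac{|\mathcal V||\mathcal P||\mathcal G|}{\delta}}{\epsilon^2(1-\gamma)^2},$$ then with probability at least $1-\delta$ over the draw of $\mathcal D$, any SBEED output $(\hat V,\hat\pi)$ satisfies $J(\pi^\star)-J(\hat\pi)\le\epsilon$.
   Context: A finite MDP $(\mathcal S,\mathcal A,\gamma,P,R,d_0)$ with $\gamma\in[0,1)$, $P(\cdot\mid s,a)\in\Delta(\mathcal S)$, $R:\mathcal S\times\mathcal A\to[0,R_{\max}]$, $d_0\in\Delta(\mathcal S)$. For a policy $\pi$ and $\lambda\ge0$, $J_\lambda(\pi)=\mathbb E\big[\sum_{t\ge0}\gamma^t(R(s_t,a_t)-\lambda\ln\pi(a_t\mid s_t))\big]$ with $s_0\sim d_0$, $a_t\sim\pi(\cdot\mid s_t)$, $s_{t+1}\sim P(\cdot\mid s_t,a_t)$; $J=J_0$. $\pi^\star$ is a deterministic maximizer of $J$, $\pi^\star_\lambda$ the maximizer of $J_\lambda$. Occupancy $d^\pi(s)=(1-\gamma)\sum_t\gamma^t\Pr(s_t=s)$, $d^\pi(s,a)=d^\pi(s)\pi(a\mid s)$. $(\mathbb PV)(s,a)=\sum_{s'}P(s'\mid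 s,a)V(s')$; consistency operator $(\mathcal C^\pi_\lambda V)(s,a)=R(s,a)+\gamma(\mathbb PV)(s,a)-\lambda\ln\pi(a\mid s)$. Data distribution $\mu\in\Delta(\mathcal S\times\mathcal A)$, $\|f\|^2_{2,\mu}=\mathbb E_{\mu}[f(s,a)^2]$ (for $V$ depending only on $s$, $V-\mathcal C^\pi_\lambda V$ is the function $(s,a)\mapsto V(s)-(\mathcal C^\pi_\lambda V)(s,a)$). $V_{\lambda,\max}=(R_{\max}+\lambda\ln|\mathcal A|)/(1-\gamma)$. Finite function classes: $\mathcal V\subset[0,V_{\lambda,\max}]^{\mathcal S}$, $\mathcal P\subset\{\pi:\|\ln\pi\|_\infty\le V_{\lambda,\max}/\lambda\}$, $\mathcal G\subset[0,2V_{\lambda,\max}]^{\mathcal S\times\mathcal A}$. Dataset $\mathcal D=\{(s_i,a_i,r_i,s_i')\}_{i=1}^n$ with $(s_i,a_i)$ i.i.d. from $\mu$, $r_i=R(s_i,a_i)$, $s_i'\sim P(\cdot\mid s_i,a_i)$ independently. Empirical losses: $\mathscr L_{\mathcal D}(V;V,\pi)=\frac1n\sum_i\big(V(s_i)-r_i-\gamma V(s_i')+\lambda\ln\pi(a_i\mid s_i)\big)^2$ and $\mathscr R_{\mathcal D}(g;V,\pi)=\frac1n\sum_i\big(g(s_i,a_i)-r_i-\gamma V(s_i')+\lambda\ln\pi(a_i\mid s_i)\big)^2$. The SBEED output is $(\hat V,\hat\pi)\in\arg\min_{V\in\mathcal V,\pi\in\mathcal P}\max_{g\in\mathcal G}\big[\mathscr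 L_{\mathcal D}(V;V,\pi)-\mathscr R_{\mathcal D}(g;V,\pi)\big]$. Concentrability: $C_2=\max_{\pi\in\mathcal P\cup\{\pi^\star_\lambda\}}\|d^\pi/\mu\|^2_{2,\mu}$. Approximation errors: $\epsilon_{\mathcal V,\mathcal P}=\min_{V\in\mathcal V,\pi\in\mathcal P}\|V-\mathcal C^\pi_\lambda V\|^2_{2,\mu}$ and $\epsilon_{\mathcal G,\mathcal V,\mathcal P}=\max_{V\in\mathcal V,\pi\in\mathcal P}\min_{g\in\mathcal G}\|g-\mathcal C^\pi_\lambda V\|^2_{2,\mu}$. *)

(* Defs.v *)
From HB Require Import structures.
From mathcomp Require Import all_boot all_order all_algebra.
From mathcomp Require Import all_classical all_reals all_analysis.
Set Implicit Arguments. Unset Strict Implicit. Unset Printing Implicit Defensive.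
Import Order.TTheory GRing.Theory Num.Theory.
Local Open Scope ring_scope.

Section SBEED.
Variables (R : realType) (S A : finType).

Definition pol := {ffun S -> {ffun A -> R}}.

Definition is_policy (pi : pol) : Prop :=
  (forall s a, 0 <= pi s a) /\ (forall s, \sum_(a : A) pi s a = 1).

Definition is_deterministic (pi : pol) : Prop :=
  forall s, exists a, pi s a = 1.

Variables (P : S -> A -> S -> R) (d0 : S -> R).

Fixpoint state_dist (pi : pol) (t : nat) : S -> R :=
  match t with
  | 0%N => d0
  | t'.+1 => fun s' => \sum_(s : S) \sum_(a : A)
                         state_dist pi t' s * pi s a * P s a s'
  end.

Definition Jlam (Rw : S -> A -> R) (gamma lam : R) (pi : pol) : R :=
  \big[+%R/0%R]_(0 <= t <oo) (gamma ^+ t *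
     \sum_(s : S) \sum_(a : A)
        state_dist pi t s * pi s a * (Rw s a - lam * ln (pi s a))).

Definition J (Rw : S -> A -> R) (gamma : R) (pi : pol) : R := Jlam Rw gamma 0 pi.

Definition occ_s (gamma : R) (pi : pol) (s : S) : R :=
  (1 - gamma) * \big[+%R/0%R]_(0 <= t <oo) (gamma ^+ t * state_dist pi t s).

Definition occ (gamma : R) (pi : pol) (s : S) (a : A) : R :=
  occ_s gamma pi s * pi s a.

Definition consist (Rw : S -> A -> R) (gamma lam : R) (pi : pol)
    (V : {ffun S -> R}) (s : S) (a : A) : R :=
  Rw s a + gamma * (\sum_(s' : S) P s a s' * V s') - lam * ln (pi s a).

Definition sqnorm_mu (mu : S -> A -> R) (f : S -> A -> R) : R :=
  \sum_(s : S) \sum_(a : A) mu s a * f s a ^+ 2.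

Definition conc (mu : S -> A -> R) (gamma : R) (pi : pol) : \bar R :=
  if `[< forall s a, mu s a = 0 -> occ gamma pi s a = 0 >]
  then (\sum_(s : S) \sum_(a : A | mu s a != 0)
          mu s a * (occ gamma pi s a / mu s a) ^+ 2)%:E
  else +oo%E.

Definition C2 (mu : S -> A -> R) (gamma : R) (Pcl : seq pol) (pilam : pol) : \bar R :=
  \big[maxe/-oo%E]_(pi <- pilam :: Pcl) conc mu gamma pi.

Definition eps_VP (Rw : S -> A -> R) (mu : S -> A -> R) (gamma lam : R)
    (Vcl : seq {ffun S -> R}) (Pcl : seq pol) : \bar R :=
  \big[mine/+oo%E]_(V <- Vcl) \big[mine/+oo%E]_(pi <- Pcl)
    (sqnorm_mu mu (fun s a => V s - consist Rw gamma lam pi V s a))%:E.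

Definition eps_GVP (Rw : S -> A -> R) (mu : S -> A -> R) (gamma lam : R)
    (Vcl : seq {ffun S -> R}) (Pcl : seq pol) (Gcl : seq {ffun S -> {ffun A -> R}}) : \bar R :=
  \big[maxe/-oo%E]_(V <- Vcl) \big[maxe/-oo%E]_(pi <- Pcl)
    \big[mine/+oo%E]_(g <- Gcl)
    (sqnorm_mu mu (fun s a => g s a - consist Rw gamma lam pi V s a))%:E.

Definition Vlmax (Rmax gamma lam : R) : R :=
  (Rmax + lam * ln (#|A|%:R)) / (1 - gamma).

(* datasets: n samples (s_i, a_i, s_i'); r_i = R(s_i,a_i) *)
Definition dataset (n : nat) := {ffun 'I_n -> (S * A * S)%type}.

Definition data_prob (mu : S -> A -> R) (n : nat) (D : dataset n) : R :=
  \prod_(i < n) (mu (D i).1.1 (D i).1.2 * P (D i).1.1 (D i).1.2 (D i).2).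

Definition loss_L (Rw : S -> A -> R) (gamma lam : R) (n : nat) (D : dataset n)
    (V : {ffun S -> R}) (pi : pol) : R :=
  n%:R^-1 * \sum_(i < n)
    (V (D i).1.1 - Rw (D i).1.1 (D i).1.2 - gamma * V (D i).2
       + lam * ln (pi (D i).1.1 (D i).1.2)) ^+ 2.

Definition loss_R (Rw : S -> A -> R) (gamma lam : R) (n : nat) (D : dataset n)
    (g : {ffun S -> {ffun A -> R}}) (V : {ffun S -> R}) (pi : pol) : R :=
  n%:R^-1 * \sum_(i < n)
    (g (D i).1.1 (D i).1.2 - Rw (D i).1.1 (D i).1.2 - gamma * V (D i).2
       + lam * ln (pi (D i).1.1 (D i).1.2)) ^+ 2.

Definition sbeed_obj (Rw : S -> A -> R) (gamma lam : R) (n : nat) (D : dataset n)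
    (Gcl : seq {ffun S -> {ffun A -> R}}) (V : {ffun S -> R}) (pi : pol) : \bar R :=
  \big[maxe/-oo%E]_(g <- Gcl)
     (loss_L Rw gamma lam D V pi - loss_R Rw gamma lam D g V pi)%:E.

Definition is_sbeed_output (Rw : S -> A -> R) (gamma lam : R) (n : nat) (D : dataset n)
    (Vcl : seq {ffun S -> R}) (Pcl : seq pol) (Gcl : seq {ffun S -> {ffun A -> R}})
    (Vh : {ffun S -> R}) (pih : pol) : Prop :=
  Vh \in Vcl /\ pih \in Pcl /\
  forall V pi, V \in Vcl -> pi \in Pcl ->
    (sbeed_obj Rw gamma lam D Gcl Vh pih <= sbeed_obj Rw gamma lam D Gcl V pi)%E.

End SBEED.

(* Main.v *)
(* Let M = V_{lambda,max}, L = ln (|V||P||G| / delta) and, for a pair (V, pi), let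
   E(V, pi) = ||V - C^pi_lambda V||^2_{2,mu}.

   Statistical part. For a sample with target y = r + gamma V(s') - lambda ln pi(a|s),
   the excess X_g = (V(s) - y)^2 - (g(s,a) - y)^2 has mean
   E_mu[(V - g)(V + g - 2 C^pi V)] and E[X_g^2] <= 49 M^2 ||V - g||^2. When g = C^pi V
   the mean is ||V - g||^2 = E(V, pi); when V = C^pi V it is - ||V - g||^2. In both cases
   the variance is dominated by the mean, so with eta of order 1 / M^2 the exponential
   moments E exp (eta E(V, pi) / 2 - eta X) and E exp (eta X) are at most 1. Markov's
   inequality for their products over the n samples, summed over all (V, pi) paired with
   an exact critic and over all critics of a fixed exact pair (V0, pi0), gives the fast
   rate n E(V, pi) <= 800 M^2 L for every output, as an output has an objective value no
   larger than that of (V0, pi0).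

   Reinforcement-learning part. The flow equation of the occupancy measure gives
   (1 - gamma) (J_lambda(pi) - E_{d0} V) = E_{d^pi}[C^pi_lambda V - V]. Applying it to the
   output and to pi*_lambda (where Gibbs' inequality replaces ln pi*_lambda by the log of
   the output policy) bounds the regularised gap by two residuals averaged under occupancy
   measures, each controlled by sqrt (C_2 E). Passing from J to J_lambda costs nothing for
   the deterministic pi* and at most lambda ln |A| / (1 - gamma) for the output. *)
Require Import Defs.
From HB Require Import structures.
From mathcomp Require Import all_boot all_order all_algebra.
From mathcomp Require Import all_classical all_reals all_analysis.
From mathcomp Require Import ring lra.
Import Order.TTheory GRing.Theory Num.Theory.
Import numFieldNormedType.Exports.
Local Open Scope classical_set_scope.
Local Open Scope ring_scope.
Set Implicit Arguments. Unset Strict Implicit. Unset Printing Implicit Defensive.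

Lemma cvgn_sum (R : realType) (I : Type) (r : seq I) (f : I -> nat -> R) (l : I -> R) :
  (forall i, f i @ \oo --> l i) ->
  (fun n => \sum_(i <- r) f i n) @ \oo --> \sum_(i <- r) l i.
Proof.
move=> fl; apply: cvg_big => [|i _]; last exact: fl.
exact: add_continuous.
Qed.

(** * Occupancy measures *)

Section occupancy.
Variables (R : realType) (S A : finType).
Variables (P : S -> A -> S -> R) (d0 : S -> R) (gamma : R) (pi : pol R S A).
Hypothesis gamma01 : 0 <= gamma < 1.
Hypothesis P_ge0 : forall s a s', 0 <= P s a s'.
Hypothesis P_sum1 : forall s a, \sum_(s' : S) P s a s' = 1.
Hypothesis d0_ge0 : forall s, 0 <= d0 s.
Hypothesis d0_sum1 : \sum_(s : S) d0 s = 1.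
Hypothesis pi_policy : is_policy pi.

Let pi_ge0 s a : 0 <= pi s a.
Proof. by case: pi_policy. Qed.

Let pi_sum1 s : \sum_(a : A) pi s a = 1.
Proof. by case: pi_policy. Qed.

Lemma state_dist_ge0 t s : 0 <= state_dist P d0 pi t s.
Proof.
elim: t s => [//|t IH] s /=.
by apply: sumr_ge0 => s1 _; apply: sumr_ge0 => a _; rewrite !mulr_ge0.
Qed.

Lemma state_dist_sum1 t : \sum_s state_dist P d0 pi t s = 1.
Proof.
elim: t => [//|t IH] /=; rewrite exchange_big /= -[RHS]IH.
apply: eq_bigr => s _; rewrite exchange_big /=.
under eq_bigr do rewrite -mulr_sumr P_sum1 mulr1.
by rewrite -mulr_sumr pi_sum1 mulr1.
Qed.

Lemma state_dist_le1 t s : state_dist P d0 pi t s <= 1.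
Proof.
rewrite -(state_dist_sum1 t) (bigD1 s) //= lerDl.
by apply: sumr_ge0 => s' _; exact: state_dist_ge0.
Qed.

Let onemg_neq0 : 1 - gamma != 0.
Proof. by case/andP: gamma01 => _ ?; rewrite subr_eq0 gt_eqF. Qed.

(** Domination by the geometric series, since state probabilities are at most 1. The infinite sum in
    [occ_s] is a [lim], which carries information only once convergence is known. *)
Lemma cvg_occ_s s :
  series (fun t => gamma ^+ t * state_dist P d0 pi t s) @ \oo -->
  (1 - gamma)^-1 * occ_s P d0 gamma pi s.
Proof.
case/andP: gamma01 => g0 g1.
rewrite /occ_s mulKf //.
suff : cvgn (series (fun t => gamma ^+ t * state_dist P d0 pi t s)) by [].
apply: (@series_le_cvg _ _ (fun t => gamma ^+ t)).
- by move=> t; rewrite mulr_ge0 ?exprn_ge0 ?state_dist_ge0.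
- by move=> t; rewrite exprn_ge0.
- by move=> t; rewrite ler_piMr ?exprn_ge0 ?state_dist_le1.
have -> : (fun t => gamma ^+ t) = geometric 1 gamma.
  by apply/funext => t; rewrite /geometric /= mul1r.
by apply: is_cvg_geometric_series; rewrite ger0_norm.
Qed.

Lemma occ_s_ge0 s : 0 <= occ_s P d0 gamma pi s.
Proof.
case/andP: gamma01 => g0 g1.
rewrite -(pmulr_rge0 _ (_ : 0 < (1 - gamma)^-1)) ?invr_gt0 ?subr_gt0 //.
have /cvg_lim <- // := @cvg_occ_s s.
apply: limr_ge; first by apply/cvg_ex; eexists; exact: cvg_occ_s.
apply: nearW => n; apply: sumr_ge0 => t _.
by rewrite mulr_ge0 ?exprn_ge0 ?state_dist_ge0.
Qed.

Lemma Jlam_occ Rw lam : Jlam P d0 Rw gamma lam pi =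
  (1 - gamma)^-1 * \sum_s \sum_a occ P d0 gamma pi s a * (Rw s a - lam * ln (pi s a)).
Proof.
rewrite /Jlam; apply: cvg_lim => //.
rewrite mulr_sumr.
have -> : (fun n => \sum_(0 <= t < n) (gamma ^+ t * \sum_s \sum_a
    state_dist P d0 pi t s * pi s a * (Rw s a - lam * ln (pi s a)))) =
  (fun n => \sum_s series (fun t => gamma ^+ t * state_dist P d0 pi t s) n *
     \sum_a pi s a * (Rw s a - lam * ln (pi s a))).
  apply/funext => n; rewrite /series /=.
  under [RHS]eq_bigr do rewrite mulr_suml.
  rewrite exchange_big /=; apply: eq_bigr => t _.
  rewrite mulr_sumr; apply: eq_bigr => s _.
  rewrite -mulrA; congr (_ * _); rewrite mulr_sumr.
  by apply: eq_bigr => a _; rewrite mulrA.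
apply: cvgn_sum => s.
have -> : (1 - gamma)^-1 * \sum_a occ P d0 gamma pi s a * (Rw s a - lam * ln (pi s a))
  = ((1 - gamma)^-1 * occ_s P d0 gamma pi s) *
     \sum_a pi s a * (Rw s a - lam * ln (pi s a)).
  rewrite -mulrA; congr (_ * _); rewrite mulr_sumr.
  by apply: eq_bigr => a _; rewrite /occ mulrA.
apply: cvgM; [exact: cvg_occ_s | exact: cvg_cst].
Qed.

(** Shifting the partial sums by one index isolates [d0] and leaves gamma times the one-step
    transport of the earlier sums. *)
Lemma occ_flow s' : occ_s P d0 gamma pi s' =
  (1 - gamma) * d0 s' + gamma * \sum_s \sum_a occ P d0 gamma pi s a * P s a s'.
Proof.
suff H : (1 - gamma)^-1 * occ_s P d0 gamma pi s' =
    d0 s' + gamma * \sum_s ((1 - gamma)^-1 * occ_s P d0 gamma pi s) *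
                      \sum_a pi s a * P s a s'.
  apply: (mulfI (invr_neq0 onemg_neq0)); rewrite H mulrDr mulKf //; congr (_ + _).
  rewrite mulrCA; congr (_ * _); rewrite mulr_sumr; apply: eq_bigr => s _.
  rewrite -mulrA; congr (_ * _); rewrite mulr_sumr.
  by apply: eq_bigr => a _; rewrite /occ mulrA.
have /cvg_lim <- // := @cvg_occ_s s'.
apply: cvg_lim => //; rewrite -(cvg_shiftS (series _)).
have -> : [sequence series (fun t => gamma ^+ t * state_dist P d0 pi t s') n.+1]_n =
  (fun n => d0 s' + gamma * \sum_s series (fun t => gamma ^+ t * state_dist P d0 pi t s) n *
     \sum_a pi s a * P s a s').
  apply/funext => n; rewrite /series /= big_nat_recl //= expr0 mul1r; congr (_ + _).
  under [in RHS]eq_bigr do rewrite mulr_suml.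
  rewrite exchange_big /= mulr_sumr; apply: eq_bigr => t _.
  rewrite exprS -mulrA; congr (_ * _); rewrite mulr_sumr; apply: eq_bigr => s _.
  rewrite -mulrA; congr (_ * _); rewrite mulr_sumr; apply: eq_bigr => a _.
  by rewrite mulrA.
apply: cvgD; first exact: cvg_cst.
apply: cvgM; first exact: cvg_cst.
apply: cvgn_sum => s; apply: cvgM; [exact: cvg_occ_s | exact: cvg_cst].
Qed.

Lemma sum_occ (f : S -> R) :
  \sum_s \sum_a occ P d0 gamma pi s a * f s = \sum_s occ_s P d0 gamma pi s * f s.
Proof.
apply: eq_bigr => s _; under eq_bigr do rewrite /occ mulrAC.
by rewrite -mulr_sumr pi_sum1 mulr1.
Qed.

Lemma sum_occ_P (f : S -> R) :
  gamma * \sum_s \sum_a occ P d0 gamma pi s a * (\sum_s' P s a s' * f s') =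
  \sum_s occ_s P d0 gamma pi s * f s - (1 - gamma) * \sum_s d0 s * f s.
Proof.
rewrite [in RHS](eq_bigr (fun s' => (1 - gamma) * (d0 s' * f s') + gamma *
  (\sum_s \sum_a occ P d0 gamma pi s a * P s a s' * f s'))); last first.
  move=> s' _; rewrite [in LHS]occ_flow mulrDl mulrA; congr (_ + _).
  rewrite -mulrA; congr (_ * _); rewrite mulr_suml.
  by apply: eq_bigr => s _; rewrite mulr_suml.
rewrite big_split /= -mulr_sumr addrAC subrr add0r -mulr_sumr; congr (_ * _).
rewrite [RHS]exchange_big /=; apply: eq_bigr => s _.
rewrite [RHS]exchange_big /=; apply: eq_bigr => a _.
by rewrite mulr_sumr; apply: eq_bigr => s' _; rewrite mulrA.
Qed.

(** The flow identity tested on the constant 1: the total mass x satisfies gamma x = x - (1 -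
    gamma). *)
Lemma sum_occ_s : \sum_s occ_s P d0 gamma pi s = 1.
Proof.
have := sum_occ_P (fun=> 1).
under eq_bigr => s _ do under eq_bigr => a _ do
  (under eq_bigr do rewrite mulr1; rewrite P_sum1).
rewrite (sum_occ (fun=> 1)); under eq_bigr do rewrite mulr1.
under [in X in _ = _ - X]eq_bigr do rewrite mulr1.
rewrite d0_sum1 => H; apply: (mulfI onemg_neq0).
move: H; set x := \sum_s _ => H; lra.
Qed.

(** The flow identity turns the transition term into the occupancy average of [V], which cancels,
    minus (1 - gamma) times its average under [d0]. *)
Lemma Jlam_residual Rw lam (V : {ffun S -> R}) :
  (1 - gamma) * (Jlam P d0 Rw gamma lam pi - \sum_s d0 s * V s) =
  \sum_s \sum_a occ P d0 gamma pi s a * (consist P Rw gamma lam pi V s a - V s).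
Proof.
rewrite Jlam_occ mulrBr mulVKf //.
transitivity (\sum_s \sum_a occ P d0 gamma pi s a * (Rw s a - lam * ln (pi s a))
  + gamma * (\sum_s \sum_a occ P d0 gamma pi s a * (\sum_s' P s a s' * V s'))
  - \sum_s \sum_a occ P d0 gamma pi s a * V s).
  by rewrite sum_occ_P sum_occ; ring.
rewrite mulr_sumr -big_split -sumrB; apply: eq_bigr => s _ /=.
rewrite mulr_sumr -big_split -sumrB; apply: eq_bigr => a _ /=.
by rewrite /consist; ring.
Qed.

End occupancy.

(** Apply ln x <= x - 1 at x = q / p, weighted by p; the upper bounds q - p sum to 0. Where p
    vanishes, the term is 0 and q - p is nonnegative. *)
Lemma gibbs (R : realType) (A : finType) (p q : A -> R) :
  (forall a, 0 <= p a) -> (forall a, 0 < q a) ->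
  \sum_a p a = 1 -> \sum_a q a = 1 ->
  \sum_a p a * ln (q a) <= \sum_a p a * ln (p a).
Proof.
move=> p0 q0 p1 q1; rewrite -subr_le0 -sumrB.
apply: (@le_trans _ _ (\sum_a (q a - p a))); last by rewrite sumrB p1 q1 subrr.
apply: ler_sum => a _.
have [->|pa] := eqVneq (p a) 0; first by rewrite !mul0r !subr0 ltW.
have pa0 : 0 < p a by rewrite lt_neqAle eq_sym pa p0.
rewrite -mulrBr -ln_div ?posrE //.
have -> : q a - p a = p a * (q a / p a - 1) by field.
rewrite ler_wpM2l // -{1}[q a / p a](subrKC 1); apply: le_ln1Dx.
by rewrite ltrBrDr addNr divr_gt0.
Qed.

(** * Suboptimality and Bellman residuals *)

Section gap.
Variables (R : realType) (S A : finType).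
Variables (P : S -> A -> S -> R) (d0 : S -> R) (gamma : R).
Variables (Rw : S -> A -> R) (mu : S -> A -> R).
Hypothesis gamma01 : 0 <= gamma < 1.
Hypothesis P_ge0 : forall s a s', 0 <= P s a s'.
Hypothesis P_sum1 : forall s a, \sum_(s' : S) P s a s' = 1.
Hypothesis d0_ge0 : forall s, 0 <= d0 s.
Hypothesis d0_sum1 : \sum_(s : S) d0 s = 1.
Hypothesis mu_ge0 : forall s a, 0 <= mu s a.
Hypothesis mu_sum1 : \sum_(s : S) \sum_(a : A) mu s a = 1.

Implicit Types pi : pol R S A.

Let onemg_gt0 : 0 < 1 - gamma.
Proof. by case/andP: gamma01 => _ ?; rewrite subr_gt0. Qed.

Let occ_s0 pi (pi_policy : is_policy pi) s : 0 <= occ_s P d0 gamma pi s.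
Proof. exact: occ_s_ge0. Qed.

(** A finite bound rules out the [+oo] branch; the sum then extends to all pairs because the factor
    [mu] kills those outside the support. *)
Lemma conc_leP pi (C : R) : (conc P d0 mu gamma pi <= C%:E)%E ->
  (forall s a, mu s a = 0 -> occ P d0 gamma pi s a = 0) /\
  \sum_s \sum_a mu s a * (occ P d0 gamma pi s a / mu s a) ^+ 2 <= C.
Proof.
rewrite /conc; case: asboolP => [H|_]; last by rewrite leNgt ltry.
rewrite lee_fin => HC; split => //; apply: le_trans HC.
apply: ler_sum => s _; rewrite [leRHS]big_mkcond /=; apply: ler_sum => a _.
by case: eqP => [->|_] //=; rewrite mul0r.
Qed.

Lemma sum_occ_mu pi (f : S -> A -> R) :
  (forall s a, mu s a = 0 -> occ P d0 gamma pi s a = 0) ->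
  \sum_s \sum_a occ P d0 gamma pi s a * f s a =
  \sum_s \sum_a mu s a * (occ P d0 gamma pi s a / mu s a * f s a).
Proof.
move=> abs; apply: eq_bigr => s _; apply: eq_bigr => a _.
have [mu0|mu0] := eqVneq (mu s a) 0; first by rewrite abs // mu0 !mul0r.
by field.
Qed.

(** The density ratio x has mean 1 under [mu], and x^2 >= 2 x - 1 pointwise. This makes the
    concentrability constant positive. *)
Lemma conc_ge1 pi (C : R) : is_policy pi ->
  (conc P d0 mu gamma pi <= C%:E)%E -> 1 <= C.
Proof.
move=> pi_policy /conc_leP[abs]; apply: le_trans.
have := sum_occ_mu (fun _ _ => 1) abs.
rewrite (sum_occ P d0 gamma pi_policy (fun=> 1)); under eq_bigr do rewrite mulr1.
rewrite (sum_occ_s gamma01 P_ge0 P_sum1 d0_ge0 d0_sum1) // => E.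
have -> : 1 = 2 * 1 - 1 :> R by ring.
rewrite [X in 2 * X]E -[X in _ - X]mu_sum1 mulr_sumr -sumrB; apply: ler_sum => s _.
rewrite mulr_sumr -sumrB; apply: ler_sum => a _; rewrite mulr1.
set x := _ / _; rewrite mulrCA -[X in _ - X]mulr1 -mulrBr ler_wpM2l //.
by have := sqr_ge0 (x - 1); rewrite sqrrB1; lra.
Qed.

(** Cauchy-Schwarz in threshold form, which avoids square roots. *)
Lemma sum_occ_le pi (C tau : R) (f : S -> A -> R) :
  0 < C -> 0 < tau -> (conc P d0 mu gamma pi <= C%:E)%E ->
  C * sqnorm_mu mu f <= tau ^+ 2 ->
  \sum_s \sum_a occ P d0 gamma pi s a * f s a <= tau.
Proof.
move=> C0 t0 /conc_leP[abs HC] Hf; rewrite sum_occ_mu //.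
(* AM-GM: x * f <= (tau / C) x^2 / 2 + (C / tau) f^2 / 2 for the density ratio x *)
apply: (@le_trans _ _ (\sum_s \sum_a (tau / (2 * C) *
   (mu s a * (occ P d0 gamma pi s a / mu s a) ^+ 2) +
   C / (2 * tau) * (mu s a * f s a ^+ 2)))).
  apply: ler_sum => s _; apply: ler_sum => a _.
  set x := _ / _.
  rewrite [tau / _ * _]mulrCA [C / _ * _]mulrCA -mulrDr ler_wpM2l // -subr_ge0.
  have -> : tau / (2 * C) * x ^+ 2 + C / (2 * tau) * f s a ^+ 2 - x * f s a =
     (2 * C * tau)^-1 * (tau * x - C * f s a) ^+ 2.
    by field; rewrite !gt_eqF.
  by rewrite mulr_ge0 ?sqr_ge0 // invr_ge0 !mulr_ge0 ?ltW.
under eq_bigr do rewrite big_split -!mulr_sumr /=.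
rewrite big_split -!mulr_sumr /= -/(sqnorm_mu mu f).
have H1 : tau / (2 * C) * (\sum_s \sum_a mu s a *
    (occ P d0 gamma pi s a / mu s a) ^+ 2) <= tau / 2.
  have -> : tau / 2 = tau / (2 * C) * C by field; rewrite gt_eqF.
  by rewrite ler_wpM2l // divr_ge0 ?mulr_ge0 ?ltW.
have H2 : C / (2 * tau) * sqnorm_mu mu f <= tau / 2.
  have -> : tau / 2 = (2 * tau)^-1 * tau ^+ 2 by field; rewrite gt_eqF.
  have -> : C / (2 * tau) * sqnorm_mu mu f = (2 * tau)^-1 * (C * sqnorm_mu mu f).
    by field; rewrite gt_eqF.
  by rewrite ler_wpM2l // invr_ge0 mulr_ge0 ?ltW.
lra.
Qed.

Lemma deterministic_entropy pi s a : is_policy pi -> is_deterministic pi ->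
  pi s a * ln (pi s a) = 0.
Proof.
move=> [pi0 pi1] /(_ s)[b pib].
have [->|ab] := eqVneq a b; first by rewrite pib ln1 mulr0.
suff -> : pi s a = 0 by rewrite mul0r.
apply/eqP; rewrite eq_le pi0 andbT.
have := pi1 s; rewrite (bigD1 b) //= (bigD1 a) //= pib.
have : 0 <= \sum_(i | (i != b) && (i != a)) pi s i by exact: sumr_ge0.
lra.
Qed.

Lemma J_eq_Jlam_deterministic pi lam : is_policy pi -> is_deterministic pi ->
  J P d0 Rw gamma pi = Jlam P d0 Rw gamma lam pi.
Proof.
move=> pi_policy det; rewrite /J !Jlam_occ //; congr (_ * _).
apply: eq_bigr => s _; apply: eq_bigr => a _.
rewrite /occ !mulrBr mul0r mulr0.
have -> : occ_s P d0 gamma pi s * pi s a * (lam * ln (pi s a)) =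
    occ_s P d0 gamma pi s * lam * (pi s a * ln (pi s a)) by ring.
by rewrite deterministic_entropy // mulr0.
Qed.

(** The difference is [lam] times the occupancy average of the entropy, which Gibbs' inequality
    against the uniform distribution bounds by ln |A|. *)
Lemma Jlam_le_J pi lam : is_policy pi -> 0 <= lam ->
  (1 - gamma) * (Jlam P d0 Rw gamma lam pi - J P d0 Rw gamma pi) <= lam * ln #|A|%:R.
Proof.
move=> pi_policy lam0; rewrite /J !Jlam_occ // mulrBr !mulVKf ?gt_eqF //.
apply: (@le_trans _ _ (\sum_s occ_s P d0 gamma pi s * (lam * ln #|A|%:R))); last first.
  by rewrite -mulr_suml (sum_occ_s gamma01 P_ge0 P_sum1 d0_ge0 d0_sum1) // mul1r.
rewrite -sumrB; apply: ler_sum => s _; rewrite -sumrB.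
have -> : \sum_a (occ P d0 gamma pi s a * (Rw s a - lam * ln (pi s a)) -
    occ P d0 gamma pi s a * (Rw s a - 0 * ln (pi s a))) =
    occ_s P d0 gamma pi s * (lam * - \sum_a pi s a * ln (pi s a)).
  rewrite -sumrN !mulr_sumr; apply: eq_bigr => a _; rewrite /occ; ring.
rewrite ler_wpM2l ?occ_s0 // ler_wpM2l // lerNl.
case: pi_policy => pi0 pi1.
have A0 : (0 < #|A|)%N.
  rewrite lt0n; apply/negP => /eqP A0; have := pi1 s.
  rewrite big_pred0; first by move/eqP; rewrite eq_sym oner_eq0.
  by move=> a; have := card0_eq A0 a.
have Ainv : 0 < #|A|%:R^-1 :> R by rewrite invr_gt0 ltr0n.
have := @gibbs R A (pi s) (fun=> #|A|%:R^-1) (pi0 s) (fun=> Ainv) (pi1 s).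
rewrite -mulr_suml pi1 mul1r lnV ?posrE ?ltr0n //; apply.
by rewrite sumr_const -[LHS]mulr_natl divff // pnatr_eq0 -lt0n.
Qed.

(** The two sides differ by [lam] times the averaged Kullback-Leibler divergence of [pi] from [pi'].
    With [pi'] the output policy, the right-hand side involves the one residual that the loss
    controls. *)
Lemma sum_occ_consist_le pi pi' lam (V : {ffun S -> R}) :
  is_policy pi -> is_policy pi' -> (forall s a, 0 < pi' s a) -> 0 <= lam ->
  \sum_s \sum_a occ P d0 gamma pi s a * (consist P Rw gamma lam pi V s a - V s) <=
  \sum_s \sum_a occ P d0 gamma pi s a * (consist P Rw gamma lam pi' V s a - V s).
Proof.
move=> pi_policy [_ pi'1] pi'0 lam0; apply: ler_sum => s _.
rewrite -subr_ge0 -sumrB.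
have -> : \sum_a (occ P d0 gamma pi s a * (consist P Rw gamma lam pi' V s a - V s) -
    occ P d0 gamma pi s a * (consist P Rw gamma lam pi V s a - V s)) =
    occ_s P d0 gamma pi s * (lam * (\sum_a pi s a * ln (pi s a) - \sum_a pi s a * ln (pi' s a))).
  rewrite -sumrB !mulr_sumr; apply: eq_bigr => a _; rewrite /occ /consist; ring.
case: (pi_policy) => pi0 pi1.
by rewrite mulr_ge0 ?occ_s0 // mulr_ge0 // subr_ge0 gibbs.
Qed.

(** Budget, in units of eps (1 - gamma): 1/4 for each of the two residual averages, whence 16 = 4^2,
    and 1/2 for the entropy of the output policy. *)
Lemma suboptimality_le (pistar pilam pih : pol R S A) (V : {ffun S -> R}) (lam eps C : R) :
  is_policy pistar -> is_deterministic pistar -> is_policy pilam ->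
  Jlam P d0 Rw gamma lam pistar <= Jlam P d0 Rw gamma lam pilam ->
  is_policy pih -> (forall s a, 0 < pih s a) ->
  (conc P d0 mu gamma pilam <= C%:E)%E -> (conc P d0 mu gamma pih <= C%:E)%E ->
  0 < eps -> 0 <= lam -> lam * (2 * ln #|A|%:R) <= (1 - gamma) * eps ->
  16 * (C * sqnorm_mu mu (fun s a => V s - consist P Rw gamma lam pih V s a))
    <= (eps * (1 - gamma)) ^+ 2 ->
  J P d0 Rw gamma pistar - J P d0 Rw gamma pih <= eps.
Proof.
move=> star_pol star_det lam_pol opt pih_pol pih0 Clam Cpih eps0 lam0 small err.
have C0 : 0 < C by apply: lt_le_trans (conc_ge1 lam_pol Clam).
have tau0 : 0 < eps * (1 - gamma) / 4 by rewrite divr_gt0 // mulr_gt0.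
set f := (fun s a => _) in err.
have fE : sqnorm_mu mu (fun s a => - f s a) = sqnorm_mu mu f.
  by apply: eq_bigr => s _; apply: eq_bigr => a _; rewrite sqrrN.
have Hf : C * sqnorm_mu mu f <= (eps * (1 - gamma) / 4) ^+ 2.
  by move: err; rewrite expr_div_n; set x := C * _; set y := _ ^+ 2; lra.
have H1 := sum_occ_le C0 tau0 Cpih Hf.
have H2 : \sum_s \sum_a occ P d0 gamma pilam s a * (- f s a) <= eps * (1 - gamma) / 4.
  by apply: (sum_occ_le C0 tau0 Clam); rewrite fE.
have E1 := Jlam_residual gamma01 P_ge0 P_sum1 d0_ge0 d0_sum1 pih_pol Rw lam V.
have E2 := Jlam_residual gamma01 P_ge0 P_sum1 d0_ge0 d0_sum1 lam_pol Rw lam V.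
have := sum_occ_consist_le V lam_pol pih_pol pih0 lam0.
have E3 := Jlam_le_J pih_pol lam0.
have E4 := J_eq_Jlam_deterministic lam star_pol star_det.
rewrite -E2 => E5.
have E6 : \sum_s \sum_a occ P d0 gamma pilam s a * (consist P Rw gamma lam pih V s a - V s)
  = \sum_s \sum_a occ P d0 gamma pilam s a * (- f s a).
  by apply: eq_bigr => s _; apply: eq_bigr => a _; rewrite /f opprB.
have E7 : \sum_s \sum_a occ P d0 gamma pih s a * (consist P Rw gamma lam pih V s a - V s)
  = - \sum_s \sum_a occ P d0 gamma pih s a * f s a.
  rewrite -sumrN; apply: eq_bigr => s _; rewrite -sumrN.
  by apply: eq_bigr => a _; rewrite /f -mulrN opprB.
rewrite E6 in E5; rewrite E7 in E1.
rewrite -(ler_pM2l onemg_gt0) E4.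
(* The optimality of [pilam] for the regularised objective enters here. *)
apply: (@le_trans _ _ ((1 - gamma) * (Jlam P d0 Rw gamma lam pilam - J P d0 Rw gamma pih))).
  by apply: ler_wpM2l; [exact: ltW | rewrite lerD2r].
move: E1 E3 E5 H1 H2 small; rewrite !mulrBr.
set a1 := (1 - gamma) * Jlam _ _ _ _ _ pih; set a2 := (1 - gamma) * Jlam _ _ _ _ _ pilam.
set a3 := (1 - gamma) * J _ _ _ _ _; set a4 := (1 - gamma) * \sum_s _.
set a5 := \sum_s _; set a6 := \sum_s _.
lra.
Qed.

End gap.

Lemma expR_le_quad (R : realType) (x : R) : x <= 1 / 2 -> expR x <= 1 + x + 2 * x ^+ 2.
Proof.
(* expR x <= 1 / (1 - x), and (1 - x) (1 + x + 2 x^2) = 1 + x^2 (1 - 2 x) *)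
move=> x2; have x1 : 0 < 1 - x by lra.
rewrite -(ler_pM2l x1); apply: (@le_trans _ _ 1).
  rewrite -(ler_pM2r (expR_gt0 (- x))) -mulrA -expRD subrr expR0 mulr1 mul1r.
  exact: expR_ge1Dx.
have : 0 <= x ^+ 2 * (1 - 2 * x) by rewrite mulr_ge0 ?sqr_ge0 //; lra.
by rewrite -subr_ge0 => H; rewrite -subr_ge0; apply: le_trans H _; lra.
Qed.

(** * Exponential moments under product measures *)

Section product_measure.
Variables (R : realType) (T : finType) (w : T -> R).
Hypothesis w_ge0 : forall x, 0 <= w x.
Hypothesis w_sum1 : \sum_x w x = 1.

Lemma sum_prod_expR n (h : T -> R) :
  \sum_(D : {ffun 'I_n -> T}) (\prod_(i < n) w (D i)) * expR (\sum_(i < n) h (D i)) =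
  (\sum_x w x * expR (h x)) ^+ n.
Proof.
rewrite -[n in RHS]card_ord -prodr_const bigA_distr_bigA /=.
by apply: eq_bigr => D _; rewrite expR_sum -big_split.
Qed.

(** The quadratic bound on [expR] gives E exp (eta X) <= 1 - b <= exp (- b), which absorbs the
    offset b. *)
Lemma mgf_le1 (X : T -> R) (eta b : R) : (forall x, eta * X x <= 1 / 2) ->
  eta * (\sum_x w x * X x) + 2 * eta ^+ 2 * (\sum_x w x * X x ^+ 2) <= - b ->
  \sum_x w x * expR (eta * X x + b) <= 1.
Proof.
move=> X12 Hb.
under eq_bigr do rewrite expRD mulrA.
have -> : 1 = expR (- b) * expR b by rewrite -expRD addNr expR0.
rewrite -mulr_suml ler_wpM2r ?expR_ge0 //.
apply: (@le_trans _ _ (1 - b)); last exact: expR_ge1Dx.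
apply: (@le_trans _ _ (\sum_x w x * (1 + eta * X x + 2 * (eta * X x) ^+ 2))).
  by apply: ler_sum => x _; rewrite ler_wpM2l // expR_le_quad.
have -> : \sum_x w x * (1 + eta * X x + 2 * (eta * X x) ^+ 2) =
   1 + (eta * (\sum_x w x * X x) + 2 * eta ^+ 2 * (\sum_x w x * X x ^+ 2)).
  rewrite -[X in X + _]w_sum1 !mulr_sumr -!big_split /=.
  by apply: eq_bigr => x _; ring.
by rewrite lerD2l.
Qed.

Lemma sum_prod1 n : \sum_(D : {ffun 'I_n -> T}) \prod_(i < n) w (D i) = 1.
Proof.
by rewrite -(bigA_distr_bigA (fun _ : 'I_n => w)) big1 // => i _.
Qed.

(** Outside [Q] some exponent exceeds ln (N / delta), so the indicator is at most delta / N times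
    the sum of the exponentials, each of expectation at most 1. Allowing [N] to exceed the size of
    [r] keeps the empty list usable. *)
Lemma union_chernoff n (I : eqType) (r : seq I) (h : I -> T -> R) (N delta : R)
    (Q : pred {ffun 'I_n -> T}) :
  0 < N -> 0 < delta -> (size r)%:R <= N ->
  (forall j, j \in r -> \sum_x w x * expR (h j x) <= 1) ->
  (forall D : {ffun 'I_n -> T},
    (forall j, j \in r -> \sum_(i < n) h j (D i) <= ln (N / delta)) -> Q D) ->
  1 - delta <= \sum_(D | Q D) \prod_(i < n) w (D i).
Proof.
move=> N0 delta0 rN mgf HQ.
have dN0 : 0 <= delta / N by rewrite divr_ge0 ?ltW.
rewrite lerBlDr -[leLHS](sum_prod1 n) [leLHS](bigID Q) /= lerD2l.
have pr0 (D : {ffun 'I_n -> T}) : 0 <= \prod_(i < n) w (D i) by exact: prodr_ge0.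
apply: (@le_trans _ _ (\sum_(D : {ffun 'I_n -> T}) (\prod_(i < n) w (D i)) *
   (delta / N * \sum_(j <- r) expR (\sum_(i < n) h j (D i))))).
  rewrite big_mkcond /=; apply: ler_sum => D _; case: ifPn => [/negP QD|_]; last first.
    apply: mulr_ge0 => //; apply: mulr_ge0 => //.
    by apply: sumr_ge0 => j _; exact: expR_ge0.
  rewrite ler_peMr //.
  have [j jr hj] : exists2 j, j \in r & ln (N / delta) < \sum_(i < n) h j (D i).
    apply: contrapT => H; apply: QD; apply: HQ => j jr.
    by rewrite leNgt; apply/negP => lt; apply: H; exists j.
  rewrite (big_rem j) //= mulrDr.
  have H1 : 1 <= delta / N * expR (\sum_(i < n) h j (D i)).
    have -> : 1 = delta / N * (N / delta) by field; rewrite !gt_eqF.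
    by rewrite ler_wpM2l // -[leLHS]lnK ?posrE ?divr_gt0 // ler_expR ltW.
  apply: le_trans H1 _; rewrite lerDl mulr_ge0 //.
  by apply: sumr_ge0 => k _; rewrite expR_ge0.
under eq_bigr do rewrite mulrCA mulr_sumr.
rewrite -mulr_sumr exchange_big /=.
apply: (@le_trans _ _ (delta / N * N)); last by rewrite divfK ?gt_eqF.
rewrite ler_wpM2l //; apply: le_trans rN.
rewrite -sum1_size natr_sum [leLHS]big_seq [leRHS]big_seq; apply: ler_sum => j jr.
rewrite sum_prod_expR exprn_ile1 ?mgf //.
by apply: sumr_ge0 => x _; rewrite mulr_ge0 ?expR_ge0.
Qed.

End product_measure.

(** Extracts witnesses from vanishing approximation errors; the first alternative covers the empty
    family, whose minimum is the unit [+oo]. *)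
Lemma bigmine_attained (R : realType) (I : eqType) (r : seq I) (F : I -> \bar R) :
  \big[mine/+oo%E]_(i <- r) F i = +oo%E \/
  exists2 i, i \in r & \big[mine/+oo%E]_(i <- r) F i = F i.
Proof.
elim: r => [|i r IH]; first by rewrite big_nil; left.
rewrite big_cons; case: leP => _.
  by right; exists i; rewrite ?mem_head.
case: IH => [->|[j jr ->]]; first by left.
by right; exists j; rewrite // inE jr orbT.
Qed.

(** * Excess loss and the fast rate *)

Section excess_loss.
Variables (R : realType) (S A : finType).
Variables (P : S -> A -> S -> R) (gamma : R) (Rw : S -> A -> R) (mu : S -> A -> R).
Variables (lam M : R).
Hypothesis gamma01 : 0 <= gamma < 1.
Hypothesis P_ge0 : forall s a s', 0 <= P s a s'.
Hypothesis P_sum1 : forall s a, \sum_(s' : S) P s a s' = 1.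
Hypothesis mu_ge0 : forall s a, 0 <= mu s a.
Hypothesis mu_sum1 : \sum_(s : S) \sum_(a : A) mu s a = 1.
Hypothesis Rw_bound : forall s a, 0 <= Rw s a <= (1 - gamma) * M.

Definition sample_prob (x : S * A * S) : R := mu x.1.1 x.1.2 * P x.1.1 x.1.2 x.2.

(** The critic [g] has type [pol] only because critics and policies share the same function type. *)
Definition excess (V : {ffun S -> R}) (pi g : pol R S A) (x : S * A * S) : R :=
  (V x.1.1 - Rw x.1.1 x.1.2 - gamma * V x.2 + lam * ln (pi x.1.1 x.1.2)) ^+ 2 -
  (g x.1.1 x.1.2 - Rw x.1.1 x.1.2 - gamma * V x.2 + lam * ln (pi x.1.1 x.1.2)) ^+ 2.

Definition residual (V : {ffun S -> R}) (pi : pol R S A) : R :=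
  sqnorm_mu mu (fun s a => V s - consist P Rw gamma lam pi V s a).

Lemma residual_ge0 V pi : 0 <= residual V pi.
Proof.
by apply: sumr_ge0 => s _; apply: sumr_ge0 => a _; rewrite mulr_ge0 ?sqr_ge0.
Qed.

Lemma sqnorm_mu_eq0 (f : S -> A -> R) s a :
  sqnorm_mu mu f = 0 -> mu s a != 0 -> f s a = 0.
Proof.
have f0 s' a' : 0 <= mu s' a' * f s' a' ^+ 2 by rewrite mulr_ge0 ?sqr_ge0.
move=> /psumr_eq0P => H mu0.
have /psumr_eq0P Hs := H (fun s' _ => sumr_ge0 _ (fun a' _ => f0 s' a')) s isT.
have /eqP := Hs (fun a' _ => f0 s a') a isT.
by rewrite mulf_eq0 (negbTE mu0) sqrf_eq0 => /eqP.
Qed.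

Lemma sample_prob_ge0 x : 0 <= sample_prob x.
Proof. by rewrite mulr_ge0. Qed.

Lemma sum_sample_prob (f : S -> A -> S -> R) :
  \sum_x sample_prob x * f x.1.1 x.1.2 x.2 =
  \sum_s \sum_a mu s a * \sum_s' P s a s' * f s a s'.
Proof.
rewrite pair_bigA /=.
rewrite -(pair_bigA _ (fun y s' => mu y.1 y.2 * P y.1 y.2 s' * f y.1 y.2 s')) /=.
apply: eq_bigr => y _; rewrite mulr_sumr; apply: eq_bigr => s' _.
by rewrite mulrA.
Qed.

Lemma sample_prob_sum1 : \sum_x sample_prob x = 1.
Proof.
transitivity (\sum_x sample_prob x * 1); first by apply: eq_bigr => x _; rewrite mulr1.
rewrite (sum_sample_prob (fun _ _ _ => 1)) -[RHS]mu_sum1.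
apply: eq_bigr => s _; apply: eq_bigr => a _.
by rewrite -mulr_suml P_sum1 !mulr1.
Qed.

Lemma loss_diffE n (D : dataset S A n) V pi g :
  loss_L Rw gamma lam D V pi - loss_R Rw gamma lam D g V pi =
  n%:R^-1 * \sum_(i < n) excess V pi g (D i).
Proof. by rewrite -mulrBr -sumrB. Qed.

Section moments.
Variables (V : {ffun S -> R}) (pi g : pol R S A).
Hypothesis V_bound : forall s, 0 <= V s <= M.
Hypothesis pi_bound : forall s a, `|lam * ln (pi s a)| <= M.
Hypothesis g_bound : forall s a, 0 <= g s a <= 2 * M.

Let target s a s' : R := Rw s a + gamma * V s' - lam * ln (pi s a).

(** Difference of squares around a common target. Only the second factor depends on s', and
    affinely, so averaging over s' replaces the target by C^pi V. *)
Let excessE x : excess V pi g x =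
  (V x.1.1 - g x.1.1 x.1.2) * (V x.1.1 + g x.1.1 x.1.2 - 2 * target x.1.1 x.1.2 x.2).
Proof. rewrite /excess /target; ring. Qed.

(** The reward and gamma V contribute (1 - gamma) M + gamma M = M, the log-policy another M. *)
Let target_bound s a s' : `|target s a s'| <= 2 * M.
Proof.
rewrite /target; have /andP[g0 g1] := gamma01.
have /andP[V0 V1] := V_bound s'; have /andP[R0 R1] := Rw_bound s a.
have := pi_bound s a; rewrite !ler_norml.
have := mulr_ge0 g0 V0; have := ler_wpM2l g0 V1.
lra.
Qed.

Let factor_bound s a s' :
  `|V s - g s a| <= 2 * M /\ `|V s + g s a - 2 * target s a s'| <= 7 * M.
Proof.
have /andP[V0 V1] := V_bound s; have /andP[g0 g1] := g_bound s a.
by have := target_bound s a s'; rewrite !ler_norml; lra.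
Qed.

Lemma excess_bound x : `|excess V pi g x| <= 14 * M ^+ 2.
Proof.
rewrite excessE normrM.
have [H1 H2] := factor_bound x.1.1 x.1.2 x.2.
have -> : 14 * M ^+ 2 = (2 * M) * (7 * M) by ring.
exact: ler_pM.
Qed.

Lemma excess_mean : \sum_x sample_prob x * excess V pi g x =
  \sum_s \sum_a mu s a * ((V s - g s a) *
    (V s + g s a - 2 * consist P Rw gamma lam pi V s a)).
Proof.
under eq_bigr do rewrite excessE.
rewrite (sum_sample_prob
  (fun s a s' => (V s - g s a) * (V s + g s a - 2 * target s a s'))).
apply: eq_bigr => s _; apply: eq_bigr => a _; congr (_ * _).
transitivity ((V s - g s a) * ((V s + g s a - 2 * (Rw s a - lam * ln (pi s a))) *
   (\sum_s' P s a s') - 2 * gamma * \sum_s' P s a s' * V s')).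
  rewrite !mulr_sumr -sumrB mulr_sumr; apply: eq_bigr => s' _.
  by rewrite /target; ring.
by rewrite P_sum1 /consist; ring.
Qed.

(** Only the second factor is bounded, by 7 M; keeping (V - g)^2 is what lets the mean dominate the
    variance and yields the fast rate. *)
Lemma excess_second_moment : \sum_x sample_prob x * excess V pi g x ^+ 2 <=
  49 * M ^+ 2 * sqnorm_mu mu (fun s a => V s - g s a).
Proof.
have -> : 49 * M ^+ 2 * sqnorm_mu mu (fun s a => V s - g s a) =
  \sum_x sample_prob x * (49 * M ^+ 2 * (V x.1.1 - g x.1.1 x.1.2) ^+ 2).
  rewrite (sum_sample_prob (fun s a s' => 49 * M ^+ 2 * (V s - g s a) ^+ 2)).
  rewrite mulr_sumr; apply: eq_bigr => s _; rewrite mulr_sumr; apply: eq_bigr => a _.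
  by rewrite -mulr_suml P_sum1; ring.
apply: ler_sum => x _; rewrite ler_wpM2l ?sample_prob_ge0 // excessE exprMn mulrC.
rewrite ler_wpM2r ?sqr_ge0 //.
have [_ H] := factor_bound x.1.1 x.1.2 x.2.
have -> : 49 * M ^+ 2 = (7 * M) ^+ 2 by ring.
by rewrite -[leLHS]real_normK ?num_real // ler_sqr ?nnegrE // (le_trans _ H).
Qed.

(** The residual at (s, a) is the conditional mean of V minus the target, of size at most M + 2 M.
    The bound settles the degenerate case M = 0. *)
Lemma residual_le : residual V pi <= 9 * M ^+ 2.
Proof.
have -> : 9 * M ^+ 2 = \sum_s \sum_a mu s a * (3 * M) ^+ 2.
  under eq_bigr do rewrite -mulr_suml.
  by rewrite -mulr_suml mu_sum1; ring.
apply: ler_sum => s _; apply: ler_sum => a _; rewrite ler_wpM2l //.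
have M0 : 0 <= M by have /andP[V0 V1] := V_bound s; exact: le_trans V1.
have -> : V s - consist P Rw gamma lam pi V s a = \sum_s' P s a s' * (V s - target s a s').
  transitivity ((V s - Rw s a + lam * ln (pi s a)) * (\sum_s' P s a s') -
    gamma * \sum_s' P s a s' * V s').
    by rewrite P_sum1 /consist; ring.
  rewrite !mulr_sumr -sumrB; apply: eq_bigr => s' _; rewrite /target; ring.
rewrite -[leLHS]real_normK ?num_real // ler_sqr ?nnegrE ?mulr_ge0 //.
apply: le_trans (ler_norm_sum _ _ _) _.
have -> : 3 * M = \sum_s' 3 * M * P s a s' by rewrite -mulr_sumr P_sum1 mulr1.
apply: ler_sum => s' _.
rewrite normrM ger0_norm // mulrC ler_wpM2r //.
have /andP[V0 V1] := V_bound s; have := target_bound s a s'.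
by rewrite !ler_norml; lra.
Qed.

Hypothesis M_gt0 : 0 < M.
(* 200 >= 4 * 49: the second-moment term eats at most half of the mean term *)
Let eta : R := (200 * M ^+ 2)^-1.

Let eta_gt0 : 0 < eta.
Proof. by rewrite invr_gt0 mulr_gt0 ?ltr0n ?exprn_gt0. Qed.

Let etaM : eta * M ^+ 2 = 200^-1.
Proof. by rewrite /eta; field; rewrite gt_eqF. Qed.

(** Here 14 / 200 <= 1 / 2, the range in which the quadratic bound on [expR] is available. *)
Let eta_excess x : `|eta * excess V pi g x| <= 1 / 2.
Proof.
rewrite normrM gtr0_norm //.
apply: le_trans (ler_wpM2l (ltW eta_gt0) (excess_bound x)) _.
by rewrite mulrCA etaM; lra.
Qed.

Let eta_second_moment : 2 * eta ^+ 2 * (\sum_x sample_prob x * excess V pi g x ^+ 2) <=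
  eta * sqnorm_mu mu (fun s a => V s - g s a) / 2.
Proof.
apply: le_trans (ler_wpM2l _ excess_second_moment) _.
  by rewrite mulr_ge0 ?sqr_ge0.
set B := sqnorm_mu _ _.
have B0 : 0 <= eta * B.
  rewrite mulr_ge0 ?(ltW eta_gt0) //; apply: sumr_ge0 => s _; apply: sumr_ge0 => a _.
  by rewrite mulr_ge0 ?sqr_ge0.
have -> : 2 * eta ^+ 2 * (49 * M ^+ 2 * B) = 98 * (eta * M ^+ 2) * (eta * B) by ring.
by rewrite etaM; lra.
Qed.

(** On the support of [mu] the critic equals C^pi V, so the mean excess and ||V - g||^2 are both the
    residual; half of the mean survives the variance and pays for the offset. *)
Lemma mgf_exact_critic :
  sqnorm_mu mu (fun s a => g s a - consist P Rw gamma lam pi V s a) = 0 ->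
  \sum_x sample_prob x * expR (- eta * excess V pi g x + eta * residual V pi / 2) <= 1.
Proof.
move=> Hg.
have gC s a : mu s a != 0 -> g s a = consist P Rw gamma lam pi V s a.
  by move=> /(sqnorm_mu_eq0 Hg)/eqP; rewrite subr_eq0 => /eqP.
apply: mgf_le1; first exact: sample_prob_ge0.
- exact: sample_prob_sum1.
- by move=> x; have := eta_excess x; rewrite ler_norml mulNr; lra.
have E1 : sqnorm_mu mu (fun s a => V s - g s a) = residual V pi.
  apply: eq_bigr => s _; apply: eq_bigr => a _.
  by have [->|/gC ->] := eqVneq (mu s a) 0; rewrite ?mul0r.
have -> : \sum_x sample_prob x * excess V pi g x = residual V pi.
  rewrite excess_mean; apply: eq_bigr => s _; apply: eq_bigr => a _.
  have [->|/gC ->] := eqVneq (mu s a) 0; first by rewrite !mul0r.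
  by congr (_ * _); ring.
by have := eta_second_moment; rewrite E1 sqrrN; lra.
Qed.

(** Now the mean excess is - ||V - g||^2, which absorbs the variance with offset 0. *)
Lemma mgf_exact_value : residual V pi = 0 ->
  \sum_x sample_prob x * expR (eta * excess V pi g x) <= 1.
Proof.
move=> HV.
have VC s a : mu s a != 0 -> consist P Rw gamma lam pi V s a = V s.
  by move=> /(sqnorm_mu_eq0 HV)/eqP; rewrite subr_eq0 => /eqP.
under eq_bigr do rewrite -[eta * _]addr0.
apply: mgf_le1; first exact: sample_prob_ge0.
- exact: sample_prob_sum1.
- by move=> x; have := eta_excess x; rewrite ler_norml; lra.
have -> : \sum_x sample_prob x * excess V pi g x = - sqnorm_mu mu (fun s a => V s - g s a).
  rewrite excess_mean -sumrN; apply: eq_bigr => s _; rewrite -sumrN; apply: eq_bigr => a _.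
  have [->|/VC ->] := eqVneq (mu s a) 0; first by rewrite !mul0r oppr0.
  by ring.
have B0 : 0 <= eta * sqnorm_mu mu (fun s a => V s - g s a).
  rewrite mulr_ge0 ?(ltW eta_gt0) //; apply: sumr_ge0 => s _; apply: sumr_ge0 => a _.
  by rewrite mulr_ge0 ?sqr_ge0.
by have := eta_second_moment; rewrite oppr0; lra.
Qed.

End moments.
End excess_loss.

(** * Uniform concentration and the residual of the output *)

Section concentration.
Variables (R : realType) (S A : finType).
Variables (P : S -> A -> S -> R) (gamma : R) (Rw : S -> A -> R) (mu : S -> A -> R).
Variables (lam M : R).
Variables (Vcl : seq {ffun S -> R}) (Pcl Gcl : seq (pol R S A)).
Hypothesis gamma01 : 0 <= gamma < 1.
Hypothesis P_ge0 : forall s a s', 0 <= P s a s'.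
Hypothesis P_sum1 : forall s a, \sum_(s' : S) P s a s' = 1.
Hypothesis mu_ge0 : forall s a, 0 <= mu s a.
Hypothesis mu_sum1 : \sum_(s : S) \sum_(a : A) mu s a = 1.
Hypothesis Rw_bound : forall s a, 0 <= Rw s a <= (1 - gamma) * M.
Hypothesis M_ge0 : 0 <= M.
Hypothesis V_bound : forall V, V \in Vcl -> forall s, 0 <= V s <= M.
Hypothesis pi_bound : forall pi, pi \in Pcl -> forall s a, `|lam * ln (pi s a)| <= M.
Hypothesis g_bound : forall g, g \in Gcl -> forall s a, 0 <= g s a <= 2 * M.
Hypothesis critic : forall V pi, V \in Vcl -> pi \in Pcl -> exists2 g, g \in Gcl &
  sqnorm_mu mu (fun s a => g s a - consist P Rw gamma lam pi V s a) = 0.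
Variables (V0 : {ffun S -> R}) (pi0 : pol R S A).
Hypothesis V0_in : V0 \in Vcl.
Hypothesis pi0_in : pi0 \in Pcl.
Hypothesis V0_residual : residual P gamma Rw mu lam V0 pi0 = 0.

(** Minimax comparison: the excess at [g] is below the inner maximum at the output, hence below the
    inner maximum at the exact pair. *)
Lemma sbeed_output_excess n (D : dataset S A n) Vh pih g (K : R) :
  is_sbeed_output Rw gamma lam D Vcl Pcl Gcl Vh pih -> g \in Gcl ->
  (forall g', g' \in Gcl -> \sum_(i < n) excess gamma Rw lam V0 pi0 g' (D i) <= K) ->
  n%:R^-1 * \sum_(i < n) excess gamma Rw lam Vh pih g (D i) <= n%:R^-1 * K.
Proof.
move=> [_ [_ /(_ _ _ V0_in pi0_in) opt]] gG HK.
rewrite -lee_fin -loss_diffE.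
apply: (@le_trans _ _ (sbeed_obj Rw gamma lam D Gcl Vh pih)).
  exact: (Order.TotalTheory.le_bigmax_seq _ _ _
    (fun g => (loss_L Rw gamma lam D Vh pih - loss_R Rw gamma lam D g Vh pih)%:E) gG isT).
apply: le_trans opt _.
rewrite /sbeed_obj big_seq; apply: bigmax_le; first exact: leNye.
by move=> g' g'G; rewrite lee_fin loss_diffE ler_wpM2l ?invr_ge0 ?HK.
Qed.

(** Stated for any event [Q] implied by the rate, so that the final event can be substituted
    directly. *)
Lemma sbeed_concentration n (delta : R) (Q : pred (dataset S A n)) :
  0 < delta < 1 ->
  (forall D, (forall Vh pih, is_sbeed_output Rw gamma lam D Vcl Pcl Gcl Vh pih ->
      n%:R * residual P gamma Rw mu lam Vh pih <=
      800 * M ^+ 2 * ln ((size Vcl * size Pcl * size Gcl)%:R / delta)) -> Q D) ->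
  1 - delta <= \sum_(D | Q D) data_prob P mu D.
Proof.
move=> /andP[delta0 delta1] HQ.
set N := (_ * _ * _)%N in HQ *.
have w0 := sample_prob_ge0 P_ge0 mu_ge0.
have w1 := sample_prob_sum1 P_sum1 mu_sum1.
have [g0 g0G _] := critic V0_in pi0_in.
have sV : (0 < size Vcl)%N by case: (Vcl) V0_in.
have sP : (0 < size Pcl)%N by case: (Pcl) pi0_in.
have sG : (0 < size Gcl)%N by case: (Gcl) g0G.
have N0 : (0 < N)%N by rewrite !muln_gt0 sV sP.
have N0R : 0 < N%:R :> R by rewrite ltr0n.
have L0 : 0 <= ln (N%:R / delta).
  apply: ln_ge0; rewrite ler_pdivlMr // mul1r (le_trans (ltW delta1)) //.
  by rewrite ler1n.
have RHS0 : 0 <= 800 * M ^+ 2 * ln (N%:R / delta).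
  apply: mulr_ge0 L0; apply: mulr_ge0; [exact: ler0n | exact: sqr_ge0].
(* If M = 0 the scale 1 / M^2 is meaningless, but every residual vanishes and the empty list of
   events suffices. *)
have [M0|M_neq0] := eqVneq M 0.
  apply: (@union_chernoff _ _ _ w0 w1 n nat [::] (fun _ _ => 0) _ delta _ N0R) => //.
  move=> D _; apply: HQ => Vh pih [VhV [pihP _]].
  apply: le_trans RHS0; rewrite mulr_ge0_le0 //.
  have := residual_le gamma01 P_ge0 P_sum1 mu_ge0 mu_sum1 Rw_bound
    (V_bound VhV) (pi_bound pihP).
  by rewrite M0 expr0n mulr0.
have M_gt0 : 0 < M by rewrite lt_neqAle eq_sym M_neq0.
set eta := (200 * M ^+ 2)^-1.
have eta0 : 0 < eta by rewrite invr_gt0 mulr_gt0 ?ltr0n ?exprn_gt0.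
(* One exact critic is fixed per pair, before the data are drawn; [g0] is the default outside the
   classes. *)
have [sel Hsel] : {sel : {ffun S -> R} * pol R S A -> pol R S A &
    forall Vpi, Vpi.1 \in Vcl -> Vpi.2 \in Pcl -> sel Vpi \in Gcl /\
    sqnorm_mu mu (fun s a => sel Vpi s a - consist P Rw gamma lam Vpi.2 Vpi.1 s a) = 0}.
  apply: (@choice _ _ (fun Vpi g => Vpi.1 \in Vcl -> Vpi.2 \in Pcl -> g \in Gcl /\
    sqnorm_mu mu (fun s a => g s a - consist P Rw gamma lam Vpi.2 Vpi.1 s a) = 0)).
  move=> [V pi] /=; have [VV|_] := boolP (V \in Vcl); last by exists g0.
  have [piP|_] := boolP (pi \in Pcl); last by exists g0.
  by have [g gG Hg] := critic VV piP; exists g.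
pose pairs := [seq (V, pi) | V <- Vcl, pi <- Pcl].
have pairs0 : (V0, pi0) \in pairs by apply/allpairsP; exists (V0, pi0).
(* Left indices bound the excess of a candidate output from below, right indices that of the exact
   pair from above. *)
pose h (j : ({ffun S -> R} * pol R S A) + pol R S A) (x : S * A * S) := match j with
  | inl Vpi => - eta * excess gamma Rw lam Vpi.1 Vpi.2 (sel Vpi) x
                 + eta * residual P gamma Rw mu lam Vpi.1 Vpi.2 / 2
  | inr g => eta * excess gamma Rw lam V0 pi0 g x
  end.
(* Dropping the exact pair (V0, pi0) leaves at most N events; with one more the
   bound would fail when all classes are singletons and delta tends to 1 *)
pose r := [seq inl Vpi | Vpi <- rem (V0, pi0) pairs] ++ [seq inr g | g <- Gcl]
  : seq (({ffun S -> R} * pol R S A) + pol R S A).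
apply: (@union_chernoff _ _ _ w0 w1 n _ r h N%:R delta Q) => //.
(* With |V||P| = k + 1, the count is k + |G| <= (k + 1) |G|. *)
- rewrite ler_nat size_cat !size_map size_rem // size_allpairs /N.
  have : (0 < size Vcl * size Pcl)%N by rewrite muln_gt0 sV.
  case: (size Vcl * size Pcl)%N => // k _.
  by rewrite mulSn addnC leq_add2l leq_pmulr.
- move=> j; rewrite mem_cat => /orP[] /mapP[] => [Vpi /mem_rem inVP|g gG] -> /=.
    move: inVP => /allpairsP[[V pi] /= [VV piP ->]] /=.
    have [selG selE] := Hsel (V, pi) VV piP.
    exact: (mgf_exact_critic gamma01 P_ge0 P_sum1 mu_ge0 mu_sum1 Rw_bound
      (V_bound VV) (pi_bound piP) (g_bound selG)).
  exact: (mgf_exact_value gamma01 P_ge0 P_sum1 mu_ge0 mu_sum1 Rw_bound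
      (V_bound V0_in) (pi_bound pi0_in) (g_bound gG)).
move=> D good; apply: HQ => Vh pih out.
(* The pair dropped from the union bound has residual 0, so the claim is immediate for it. *)
have [/[dup] [[-> ->]] _|neq] := eqVneq (Vh, pih) (V0, pi0).
  by rewrite V0_residual mulr0.
have [VhV [pihP _]] := out.
have [selG _] := Hsel (Vh, pih) VhV pihP.
have [n0|n0] := eqVneq n 0%N; first by move: RHS0; rewrite [in n%:R]n0 mul0r.
have n_gt0 : 0 < n%:R :> R by rewrite ltr0n lt0n.
have upper : \sum_(i < n) excess gamma Rw lam Vh pih (sel (Vh, pih)) (D i) <=
    ln (N%:R / delta) / eta.
  rewrite -(ler_pM2l (_ : 0 < n%:R^-1 :> R)) ?invr_gt0 //.
  apply: sbeed_output_excess out selG _ => g gG.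
  rewrite ler_pdivlMr // mulrC mulr_sumr.
  apply: (good (inr g)).
  by rewrite mem_cat map_f ?orbT.
have lower : \sum_(i < n) h (inl (Vh, pih)) (D i) <= ln (N%:R / delta).
  apply: good; rewrite mem_cat map_f //.
  by rewrite rem_mem //; apply/allpairsP; exists (Vh, pih).
move: lower upper; rewrite /= big_split /= -mulr_sumr sumr_const card_ord.
set X := \sum_(i < n) _; rewrite ler_pdivlMr // -[_ *+ n]mulr_natl => lower upper.
(* With X the total excess, n eta E / 2 <= L + eta X and eta X <= L give n E <= 4 L / eta, and 4 *
   200 = 800. *)
have -> : 800 * M ^+ 2 * ln (N%:R / delta) = 4 / eta * ln (N%:R / delta).
  by rewrite /eta invrK; ring.
rewrite mulrAC ler_pdivlMr //.
move: lower upper; set E := residual _ _ _ _ _ _ _; set L := ln _.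
have -> : n%:R * (eta * E / 2) = (n%:R * E * eta) / 2 by ring.
lra.
Qed.

End concentration.

(** * Consequences of zero approximation errors and finite concentrability *)

Section hypotheses.
Variables (R : realType) (S A : finType).
Variables (P : S -> A -> S -> R) (gamma : R) (Rw : S -> A -> R) (mu : S -> A -> R).
Variable (lam : R).
Hypothesis mu_ge0 : forall s a, 0 <= mu s a.

Let sqnorm_mu_ge0 (f : S -> A -> R) : 0 <= sqnorm_mu mu f.
Proof.
by apply: sumr_ge0 => s _; apply: sumr_ge0 => a _; rewrite mulr_ge0 ?sqr_ge0.
Qed.

Lemma eps_VP_eq0 (Vcl : seq {ffun S -> R}) (Pcl : seq (pol R S A)) :
  eps_VP P Rw mu gamma lam Vcl Pcl = 0%E ->
  exists V pi, [/\ V \in Vcl, pi \in Pcl & residual P gamma Rw mu lam V pi = 0].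
Proof.
rewrite /eps_VP => H.
case: (bigmine_attained Vcl (fun V => \big[mine/+oo%E]_(pi <- Pcl)
  (residual P gamma Rw mu lam V pi)%:E)) => [|[V VV]]; rewrite H // => /esym H1.
case: (bigmine_attained Pcl (fun pi => (residual P gamma Rw mu lam V pi)%:E))
  => [|[pi piP]]; rewrite H1 // => - [E].
by exists V, pi.
Qed.

(** The inner minimum lies below the maximum 0, so it is not [+oo] and is attained; nonnegativity
    makes it 0. *)
Lemma eps_GVP_eq0 (Vcl : seq {ffun S -> R}) (Pcl Gcl : seq (pol R S A)) V pi :
  eps_GVP P Rw mu gamma lam Vcl Pcl Gcl = 0%E -> V \in Vcl -> pi \in Pcl ->
  exists2 g, g \in Gcl &
    sqnorm_mu mu (fun s a => g s a - consist P Rw gamma lam pi V s a) = 0.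
Proof.
move=> H VV piP.
pose F (V' : {ffun S -> R}) (pi' g : pol R S A) :=
  (sqnorm_mu mu (fun s a => g s a - consist P Rw gamma lam pi' V' s a))%:E.
have le0 : (\big[mine/+oo%E]_(g <- Gcl) F V pi g <= 0)%E.
  rewrite -H; apply: le_trans (Order.TotalTheory.le_bigmax_seq -oo%E _ _
    (fun V' => \big[maxe/-oo%E]_(pi' <- Pcl) \big[mine/+oo%E]_(g <- Gcl) F V' pi' g) VV isT).
  exact: (Order.TotalTheory.le_bigmax_seq -oo%E _ _
    (fun pi' => \big[mine/+oo%E]_(g <- Gcl) F V pi' g) piP isT).
case: (bigmine_attained Gcl (F V pi)) => [E|[g gG E]]; rewrite E in le0.
  by move: le0; rewrite leNgt ltry.
by exists g => //; apply/eqP; rewrite eq_le sqnorm_mu_ge0 andbT -lee_fin.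
Qed.

(** [fine] loses nothing: the presence of [pilam] in the family keeps the maximum above [-oo]. *)
Lemma conc_le_C2 d0 (Pcl : seq (pol R S A)) pilam pi :
  (C2 P d0 mu gamma Pcl pilam < +oo)%E -> pi \in pilam :: Pcl ->
  (conc P d0 mu gamma pi <= (fine (C2 P d0 mu gamma Pcl pilam))%:E)%E.
Proof.
move=> fin.
have conc_le pi' : pi' \in pilam :: Pcl ->
    (conc P d0 mu gamma pi' <= C2 P d0 mu gamma Pcl pilam)%E.
  by move=> pi'P; exact: (Order.TotalTheory.le_bigmax_seq _ _ _ (conc P d0 mu gamma) pi'P isT).
have C2_gtNy : (-oo < C2 P d0 mu gamma Pcl pilam)%E.
  apply: lt_le_trans (conc_le pilam (mem_head _ _)).
  by rewrite /conc; case: ifP => _ //; rewrite ltNyr.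
by rewrite fineK ?fin_real ?C2_gtNy //; exact: conc_le.
Qed.

End hypotheses.

(** The constant is a natural number so that it precedes the choice of the real field. The condition
    on [lam] is a product because ln |A| = 0 when |A| = 1. As [ln] is 0 at 0, positivity of the
    policies accompanies the bound on their logarithms. *)
Theorem theorem2 :
  exists c : nat, (0 < c)%N /\
  forall (R : realType) (S A : finType)
    (gamma : R) (P : S -> A -> S -> R) (Rw : S -> A -> R) (Rmax : R) (d0 : S -> R)
    (mu : S -> A -> R) (lam eps delta : R) (n : nat)
    (Vcl : seq {ffun S -> R}) (Pcl : seq (pol R S A))
    (Gcl : seq {ffun S -> {ffun A -> R}})
    (pistar pistar_lam : pol R S A),
    (* the MDP *)
    0 <= gamma < 1 ->
    (forall s a s', 0 <= P s a s') -> (forall s a, \sum_(s' : S) P s a s' = 1) ->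
    (forall s a, 0 <= Rw s a <= Rmax) ->
    (forall s, 0 <= d0 s) -> \sum_(s : S) d0 s = 1 ->
    (* optimal policies *)
    is_policy pistar -> is_deterministic pistar ->
    (forall pi, is_policy pi -> J P d0 Rw gamma pi <= J P d0 Rw gamma pistar) ->
    is_policy pistar_lam ->
    (forall pi, is_policy pi ->
       Jlam P d0 Rw gamma lam pi <= Jlam P d0 Rw gamma lam pistar_lam) ->
    (* data distribution *)
    (forall s a, 0 <= mu s a) -> \sum_(s : S) \sum_(a : A) mu s a = 1 ->
    (* finite function classes *)
    uniq Vcl -> uniq Pcl -> uniq Gcl ->
    (forall V, V \in Vcl -> forall s, 0 <= V s <= Vlmax A Rmax gamma lam) ->
    (forall pi, pi \in Pcl -> is_policy pi /\
       forall s a, 0 < pi s a /\ `|ln (pi s a)| <= Vlmax A Rmax gamma lam / lam) ->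
    (forall g, g \in Gcl -> forall s a, 0 <= g s a <= 2 * Vlmax A Rmax gamma lam) ->
    (* hypotheses of the theorem *)
    0 < eps -> 0 < delta < 1 ->
    (C2 P d0 mu gamma Pcl pistar_lam < +oo)%E ->
    eps_GVP P Rw mu gamma lam Vcl Pcl Gcl = 0%E ->
    eps_VP P Rw mu gamma lam Vcl Pcl = 0%E ->
    0 < lam -> lam * (2 * ln (#|A|%:R)) <= (1 - gamma) * eps ->
    c%:R * (fine (C2 P d0 mu gamma Pcl pistar_lam) * Vlmax A Rmax gamma lam ^+ 2
            * ln ((size Vcl * size Pcl * size Gcl)%:R / delta))
      / (eps ^+ 2 * (1 - gamma) ^+ 2) <= n%:R ->
    1 - delta <=
      \sum_(D : dataset S A n |
             `[< forall Vh pih, is_sbeed_output Rw gamma lam D Vcl Pcl Gcl Vh pih ->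
                   J P d0 Rw gamma pistar - J P d0 Rw gamma pih <= eps >])
        data_prob P mu D.
Proof.
(* 12800 = 16 * 800, the constants of [suboptimality_le] and [sbeed_concentration]. *)
exists 12800%N; split => // R S A gamma P Rw Rmax d0 mu lam eps delta n Vcl Pcl Gcl
  pistar pilam gamma01 P_ge0 P_sum1 Rw_bd d0_ge0 d0_sum1 star_pol star_det _
  lam_pol lam_opt mu_ge0 mu_sum1 _ _ _ V_bd pi_bd g_bd eps0 delta01 C2fin GVP VP
  lam0 lam_small n_large.
set M := Vlmax A Rmax gamma lam in V_bd pi_bd g_bd n_large.
set N := (_ * _ * _)%N in n_large.
set C := fine _ in n_large.
have onemg0 : 0 < 1 - gamma by case/andP: gamma01 => _ ?; rewrite subr_gt0.
have concC pi : pi \in pilam :: Pcl -> (conc P d0 mu gamma pi <= C%:E)%E.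
  exact: conc_le_C2.
have C1 : 1 <= C.
  exact: (conc_ge1 gamma01 P_ge0 P_sum1 d0_ge0 d0_sum1 mu_ge0 mu_sum1 lam_pol
    (concC _ (mem_head _ _))).
have [V0 [pi0 [V0V pi0P V0_res]]] := eps_VP_eq0 VP.

have Mdef : (1 - gamma) * M = Rmax + lam * ln #|A|%:R.
  by rewrite mulrC divfK // gt_eqF.
(* Probabilities summing to 1 force states and actions to exist; this gives |A| >= 1 and, through
   the rewards, M >= 0. *)
have [s _] : exists s : S, True.
  apply: contrapT => nos; have /eqP := d0_sum1.
  rewrite big1 ?(eq_sym 0) ?oner_eq0 // => s; case: nos; by exists s.
have [a _] : exists a : A, True.
  apply: contrapT => noa; have /eqP := (proj2 star_pol) s.
  rewrite big1 ?(eq_sym 0) ?oner_eq0 // => a; case: noa; by exists a.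
have lnA0 : 0 <= ln #|A|%:R :> R.
  by rewrite ln_ge0 // ler1n; apply/card_gt0P; exists a.
have lamln0 : 0 <= lam * ln #|A|%:R by rewrite mulr_ge0 // ltW.
have M0 : 0 <= M.
  rewrite -(pmulr_rge0 _ onemg0) Mdef addr_ge0 //.
  by have /andP[/le_trans H /H] := Rw_bd s a.
have Rw_bound s' a' : 0 <= Rw s' a' <= (1 - gamma) * M.
  have /andP[-> H] := Rw_bd s' a'; rewrite Mdef /=; lra.
have pi_bound pi : pi \in Pcl -> forall s a, `|lam * ln (pi s a)| <= M.
  move=> /pi_bd[_ piB] s' a'; rewrite normrM gtr0_norm // mulrC -ler_pdivlMr //.
  by have [] := piB s' a'.
apply: (sbeed_concentration gamma01 P_ge0 P_sum1 mu_ge0 mu_sum1 Rw_bound M0 V_bd pi_bound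
  g_bd _ V0V pi0P V0_res delta01) => [V pi VV piP|D good].
  exact: eps_GVP_eq0 GVP VV piP.
apply/asboolP => Vh pih out.
have [VhV [pihP _]] := out.
have [pih_pol pih_bd] := pi_bd _ pihP.
have {}good := good _ _ out; rewrite -/N in good.
apply: (suboptimality_le (V := Vh) (C := C) gamma01 P_ge0 P_sum1 d0_ge0 d0_sum1
  mu_ge0 mu_sum1 star_pol star_det lam_pol (lam_opt _ star_pol) pih_pol _ _ _ eps0
  (ltW lam0) lam_small).
- by move=> s' a'; case: (pih_bd s' a').
- exact/concC/mem_head.
- by apply: concC; rewrite inE pihP orbT.
rewrite -/(residual P gamma Rw mu lam Vh pih).
have res_le := residual_le gamma01 P_ge0 P_sum1 mu_ge0 mu_sum1 Rw_bound
  (V_bd _ VhV) (pi_bound _ pihP).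
have res_ge0 := residual_ge0 P gamma Rw lam mu_ge0 Vh pih.
set E := residual _ _ _ _ _ _ _ in good res_le res_ge0 *.
have [M_eq0|M_neq0] := eqVneq M 0.
  have -> : E = 0.
    by apply/eqP; rewrite eq_le res_ge0 andbT; move: res_le; rewrite M_eq0 expr0n mulr0.
  by rewrite !mulr0 sqr_ge0.
have eg0 : 0 < eps ^+ 2 * (1 - gamma) ^+ 2 by rewrite mulr_gt0 ?exprn_gt0.
have L0 : 0 < ln (N%:R / delta).
  have /andP[delta0 delta1] := delta01.
  have [g0 g0G _] := eps_GVP_eq0 mu_ge0 GVP V0V pi0P.
  rewrite ln_gt0 // ltr_pdivlMr // mul1r (lt_le_trans delta1) // ler1n.
  rewrite !muln_gt0 -!has_predT.
  by apply/andP; split; [apply/andP; split|]; apply/hasP; [exists V0|exists pi0|exists g0].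
set L := ln _ in good L0 n_large.
rewrite ler_pdivrMr // in n_large.
have CML0 : 0 < C * M ^+ 2 * L.
  have C0 : 0 < C by apply: lt_le_trans C1.
  by rewrite mulr_gt0 // mulr_gt0 // exprn_gt0 // lt_neqAle eq_sym M_neq0.
(* The sample-size condition has a positive lower bound, which excludes n = 0 and allows cancelling
   n. *)
have n0 : 0 < n%:R :> R.
  by rewrite -(pmulr_lgt0 _ eg0); apply: lt_le_trans n_large; rewrite mulr_gt0 // ltr0n.
rewrite exprMn -(ler_pM2l n0); apply: le_trans n_large.
have : C * (n%:R * E) <= C * (800 * M ^+ 2 * L).
  by rewrite ler_wpM2l // (le_trans ler01 C1).
have -> : n%:R * (16 * (C * E)) = 16 * (C * (n%:R * E)) by ring.
have -> : 12800%:R * (C * M ^+ 2 * L) = 16 * (C * (800 * M ^+ 2 * L)) by ring.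
by move=> H; rewrite ler_pM2l // ltr0n.
Qed.
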